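(* Let $M$ be a rank $3$ simple matroid with $n$ elements, with $g$ and $d$ equal to the genus of $\Gamma_M$ and the degree of $D_M$ respectively. If $\rho=\rho(g,2,d)\geq 0$, then $M$ is one of the following matroids: (1) the one element extension of the uniform matroid $U_{2,n-1}$, with $\rho=n-2$; (2) the uniform matroid $U_{3,4}$, with $\rho=0$; (3) the matroid defined by the vectors $(1,0,0)$, $(1,0,1)$, $(0,0,1)$, $(0,1,1)$, $(0,1,0)$, with $\rho=1$; (4) the matroid defined by the vectors in (3) together with $(1,0,\lambda)$ for any element $\lambda$ of the field other than $1$ and $0$, with $\rho=0$; (5) the matroid consisting of the points of intersection between any pair in a collection of $4$ generic lines, for which we can take the coordinates to be the vectors from (3) together with $(1,1,1)$, with $\rho=0$.
   Context: A rank $3$ simple matroid $M$ consists of a finite set $E$ of elements and a collection $F$ of subsets of $E$, called flats (always meaning rank $2$ flats), such that any pair of (distinct) elements is contained in exactly one flat, and such that there are at least two flats. A set of pairwise non-proportional vectors spanning a $3$-dimensional vector space over a field defines such a matroid, whose elements are the vectors and whose flats are the maximal subsets (of size at least two) spanning a $2$-dimensional subspace. The graph $\Gamma_M$ is the bipartite graph with vertex set $E\amalg F$ and an edge between $e\in E$ and $f\in F$ when $e\in f$; its genus is (number of edges) $-$ (number of vertices) $+1$. The divisor $D_M$ on $\Gamma_M$ is the sum of all vertices corresponding to elements of $E$, and its degree is the number of elements. The expected dimension is $\rho(g,r,d)=g-(r+1)(g+r-d)$. The one element extension of $U_{2,n-1}$ in (1) is the rank $3$ matroid with $n$ elements in which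 $n-1$ of the elements form one flat and each pair consisting of the remaining element and one of those $n-1$ elements is a two-element flat. $U_{3,4}$ is the matroid on $4$ elements whose flats are all two-element subsets. *)

(* Defs.v *)
From HB Require Import structures.
From mathcomp Require Import all_boot all_order all_algebra.

Set Implicit Arguments.
Unset Strict Implicit.
Unset Printing Implicit Defensive.

Import Order.TTheory GRing.Theory Num.Theory.
Local Open Scope ring_scope.

(* A rank 3 simple matroid whose set of elements is the whole of E.  Only the
   rank 2 flats are recorded; a rank 2 flat has at least two elements, which
   [flat_gt1] makes explicit (it excludes the empty set and singletons). *)
Record matroid3 (E : finType) := Matroid3 {
  flats : {set {set E}};
  flat_gt1 : forall f, f \in flats -> (1 < #|f|)%N;
  flat_pair : forall x y : E, x != y ->
    exists! f, [/\ f \in flats, x \in f & y \in f];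
  flats_gt1 : (1 < #|flats|)%N
}.

Definition flats_iso (E E' : finType)
    (F : {set {set E}}) (F' : {set {set E'}}) : Prop :=
  exists2 phi : E -> E', bijective phi & [set phi @: f | f : {set E} in F] = F'.

(* Finite simple graphs are symmetric irreflexive relations on a finType. *)
Definition edges (V : finType) (adj : rel V) : {set {set V}} :=
  [set A : {set V} | [exists u, exists v, adj u v && (A == [set u; v])]].

Definition genus (V : finType) (adj : rel V) : int :=
  #|edges adj|%:Z - #|V|%:Z + 1.

Definition divisor (V : finType) := {ffun V -> int}.

Definition degree (V : finType) (D : divisor V) : int := \sum_v D v.

Definition vertexM (E : finType) (M : matroid3 E) : finType :=
  (E + {f : {set E} | f \in flats M})%type.

Definition GammaM (E : finType) (M : matroid3 E) : rel (vertexM M) :=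
  fun u v => match u, v with
  | inl e, inr f => e \in val f
  | inr f, inl e => e \in val f
  | _, _ => false
  end.

Definition divM (E : finType) (M : matroid3 E) : divisor (vertexM M) :=
  [ffun v : vertexM M => if v is inl _ then 1%:Z else 0%:Z].

Definition rho (g r d : int) : int := g - (r + 1) * (g + r - d).

(* One element extension of U_{2,m}: the elements [Some i] form one flat, and
   the additional element [None] forms a two-element flat with each of them. *)
Definition ext_U2 (m : nat) : {set {set option 'I_m}} :=
  [set Some i | i : 'I_m] |: [set [set None; Some i] | i : 'I_m].

Definition U3 (n : nat) : {set {set 'I_n}} := [set A : {set 'I_n} | #|A| == 2%N].

(* Dimension of the span of the vectors indexed by A. *)
Definition span_dim (K : fieldType) (E : finType) (v : E -> 'rV[K]_3)
    (A : {set E}) : nat :=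
  \rank (\sum_(e in A) <<v e>>)%MS.

Definition vec_flats (K : fieldType) (E : finType) (v : E -> 'rV[K]_3) :
    {set {set E}} :=
  [set A | maxset (fun B : {set E} => (1 < #|B|)%N && (span_dim v B == 2%N)) A].

Definition vec3 (K : fieldType) (a b c : K) : 'rV[K]_3 :=
  \row_(j < 3) [:: a; b; c]`_j.

Definition five_vecs (K : fieldType) : 5.-tuple 'rV[K]_3 :=
  [tuple vec3 1 0 0; vec3 1 0 1; vec3 0 0 1; vec3 0 1 1; vec3 0 1 0].

Definition six_vecs (K : fieldType) (w : 'rV[K]_3) : 6.-tuple 'rV[K]_3 :=
  [tuple of rcons (five_vecs K) w].

Definition pair4 : finType := {A : {set 'I_4} | #|A| == 2%N}.

(* The lines of the projective plane are given by their coefficient vectors;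
   four of them are generic when no three have a common point. *)
Definition generic_lines (K : fieldType) (l : 'I_4 -> 'rV[K]_3) : Prop :=
  forall A : {set 'I_4}, #|A| = 3%N -> span_dim l A = 3%N.

(* [p A] is a vector representing the point common to the two lines in A. *)
Definition intersection_points (K : fieldType) (l : 'I_4 -> 'rV[K]_3)
    (p : pair4 -> 'rV[K]_3) : Prop :=
  forall A : pair4,
    p A != 0 /\ forall i : 'I_4, i \in val A -> p A *m (l i)^T = 0.

Definition is_ext_U2 (E : finType) (M : matroid3 E) : Prop :=
  flats_iso (flats M) (ext_U2 #|E|.-1).

Definition is_U34 (E : finType) (M : matroid3 E) : Prop :=
  flats_iso (flats M) (U3 4).

(* The matroids below do not depend on the field, nor on lambda, so "the"
   matroid defined by such vectors is isomorphic to the one obtained from any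
   choice of them. *)
Definition is_five_vecs (E : finType) (M : matroid3 E) : Prop :=
  forall K : fieldType, flats_iso (flats M) (vec_flats (tnth (five_vecs K))).

Definition is_six_vecs (E : finType) (M : matroid3 E) : Prop :=
  forall (K : fieldType) (lambda : K), lambda != 0 -> lambda != 1 ->
  flats_iso (flats M) (vec_flats (tnth (six_vecs (vec3 1 0 lambda)))).

Definition is_four_lines (E : finType) (M : matroid3 E) : Prop :=
  (forall (K : fieldType) (l : 'I_4 -> 'rV[K]_3) (p : pair4 -> 'rV[K]_3),
     generic_lines l -> intersection_points l p ->
     flats_iso (flats M) (vec_flats p))
  /\ (forall K : fieldType,
        flats_iso (flats M) (vec_flats (tnth (six_vecs (vec3 (1 : K) 1 1))))).

(* Main.v *)
Require Import Defs.
From HB Require Import structures.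
From mathcomp Require Import all_boot all_order all_algebra.
From mathcomp Require Import zify.

(** Write n for the number of points and w for the sum of |f| - 1 over the
    flats f.  Counting edges and vertices of the incidence graph gives
    rho = 5 n - 8 - 2 w, so rho >= 0 means that the flats weigh little.

    Let L be a flat with the largest number k of points, and t = n - k.  The
    flats through a point p, deprived of p, partition the other points
    ([pencil_sum]), so each point of L lies on flats of weight t in total besides
    L, and no flat other than L is counted for two points of L.  Therefore
    w = (k - 1) + k t + (weight of the flats disjoint from L)
    ([flat_weight_split]), and rho >= 0 forces 2 k t + 6 <= 3 k + 5 t.  For
    t = 1 this always holds, and M is the one element extension of a uniform
    matroid.  For t >= 2 it leaves k = 2, where all flats are pairs and counting
    pairs of points gives n = 4, and the values (3, 2), (4, 2), (3, 3) of (k, t)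
    ([max_flat_cases]); for these three values no flat is disjoint from L.

    If t = 2, the line through the two points off L has to meet L, so M consists
    of two lines with a common point.  If k = t = 3, counting points and pairs
    shows that there are four flats of size three and that each of the six points
    lies on exactly two of them, so the points are the six intersections of four
    lines ([quadrilateral_exists]).

    For the coordinates, [flats_iso_vec] says that vectors represent M as soon as
    each flat of M is cut out by a linear form.  The forms come from formulas
    valid over every field: for two lines through (0,0,1) the form cutting out
    the pair (1,0,t), (0,1,s) is (t,s,-1) ([flats_iso_two_lines]), and for four
    generic lines l_i the linear relation sum a_i l_i = 0 supplies the forms
    a_i l_i + a_j l_j of the three diagonals ([flats_iso_quadrilateral]). *)

Set Implicit Arguments.
Unset Strict Implicit.
Unset Printing Implicit Defensive.

Import Order.TTheory GRing.Theory Num.Theory.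
Local Open Scope ring_scope.

(** * Points and flats *)

Lemma flat_uniq (E : finType) (M : matroid3 E) (f f' : {set E}) (x y : E) :
  f \in flats M -> f' \in flats M -> x != y ->
  x \in f -> y \in f -> x \in f' -> y \in f' -> f = f'.
Proof.
move=> fF f'F xy xf yf xf' yf'.
have [h [_ uniq_h]] := flat_pair M xy.
by rewrite -(uniq_h f) // -(uniq_h f').
Qed.

Lemma flat_through (E : finType) (M : matroid3 E) (x y : E) : x != y ->
  exists f, [/\ f \in flats M, x \in f & y \in f].
Proof. by move=> xy; have [f []] := flat_pair M xy; exists f. Qed.

Lemma flat_two (E : finType) (M : matroid3 E) (f : {set E}) :
  f \in flats M -> exists x y, [/\ x \in f, y \in f & x != y].
Proof. by move=> /flat_gt1/card_gt1P. Qed.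

Lemma flat_sub_eq (E : finType) (M : matroid3 E) (f f' : {set E}) :
  f \in flats M -> f' \in flats M -> f \subset f' -> f = f'.
Proof.
move=> fF f'F /subsetP sff'; have [x [y [xf yf xy]]] := flat_two fF.
by apply: (flat_uniq fF f'F xy); rewrite ?sff'.
Qed.

(** A flat containing every point would contain, hence equal, each of the at
    least two flats. *)
Lemma flat_missing (E : finType) (M : matroid3 E) (f : {set E}) :
  f \in flats M -> exists x, x \notin f.
Proof.
move=> fF; case: (set_0Vmem (~: f)) => [f0|[x]]; last by rewrite inE; exists x.
have fT : f = setT by rewrite -[f]setCK f0 setC0.
have /card_gt1P[h [h' [hF h'F]]] := flats_gt1 M.
rewrite (flat_sub_eq hF fF) ?fT ?subsetT //.
by rewrite (flat_sub_eq h'F fF) ?fT ?subsetT ?eqxx.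
Qed.

(** Two points are separated by a flat: join the first one to a point off the
    line through both. *)
Lemma flat_separate (E : finType) (M : matroid3 E) (x y : E) : x != y ->
  exists f, [/\ f \in flats M, x \in f & y \notin f].
Proof.
move=> xy; have [f [fF xf yf]] := flat_through M xy.
have [z zf] := flat_missing fF.
have xz : x != z by apply: contraNneq zf => <-.
have [h [hF xh zh]] := flat_through M xz.
exists h; split=> //; apply: contra zf => yh.
by rewrite (flat_uniq fF hF xy).
Qed.

(** If x lies on a flat, another point of this flat is separated from x. *)
Lemma flat_avoid (E : finType) (M : matroid3 E) (x : E) :
  exists2 f, f \in flats M & x \notin f.
Proof.
have /card_gt1P[f [f' [fF f'F ff']]] := flats_gt1 M.
case: (boolP (x \in f)) => [xf|]; last by exists f.
have [y [z [yf zf yz]]] := flat_two fF.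
have [w [wf wx]] : exists w, w \in f /\ w != x.
  by case: (eqVneq y x) => [e|]; [exists z; rewrite -e eq_sym | exists y].
by have [h [hF wh xh]] := flat_separate M wx; exists h.
Qed.

(** * Counting incidences *)

(** With |f| - 1 as the weight of f, all pencils weigh n - 1; it is also what a
    flat contributes to the difference between edges and flats in the incidence
    graph. *)
Definition flat_weight (E : finType) (M : matroid3 E) : nat :=
  \sum_(f in flats M) #|f|.-1.

(** The flats through a point, with the point removed, partition the other
    points. *)
Lemma pencil_sum (E : finType) (M : matroid3 E) (p : E) :
  (\sum_(f in flats M | p \in f) #|f|.-1 = #|E|.-1)%N.
Proof.
transitivity (\sum_(f in flats M | p \in f)
    \sum_(q | q != p) (q \in f : nat))%N.
  apply: eq_bigr => f /andP[_ pf].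
  rewrite (cardsD1 p f) pf /= -sum1_card -big_mkcondr.
  by apply: eq_bigl => q; rewrite !inE.
rewrite exchange_big /= -(cardC1 p) -sum1_card; apply: eq_bigr => q qp.
have pq : p != q by rewrite eq_sym.
have [f [fF pf qf]] := flat_through M pq.
rewrite (bigD1 f) ?fF ?pf //= qf big1 ?addn0 // => h /andP[/andP[hF ph] hf].
apply/eqP; rewrite eqb0; apply: contra hf => qh.
by rewrite (flat_uniq hF fF pq).
Qed.

(** Sum the pencils over all points. *)
Lemma flat_pairs_sum (E : finType) (M : matroid3 E) :
  (\sum_(f in flats M) #|f| * #|f|.-1 = #|E| * #|E|.-1)%N.
Proof.
rewrite -sum_nat_const -(eq_bigr _ (fun p _ => pencil_sum M p)).
rewrite (exchange_big_dep (mem (flats M))) /=; last by move=> p f _ /andP[].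
apply: eq_bigr => f fF; rewrite -sum_nat_const.
by apply: eq_bigl => p; rewrite fF.
Qed.

(** Sum the pencils over the points of L: a flat other than L is counted once
    when it meets L, and not at all otherwise. *)
Lemma flat_weight_split (E : finType) (M : matroid3 E) (L : {set E}) :
  L \in flats M ->
  (flat_weight M = #|L|.-1 + #|L| * (#|E| - #|L|)
                   + \sum_(f in flats M | [disjoint f & L]) #|f|.-1)%N.
Proof.
move=> LF; have Lgt1 := flat_gt1 LF.
rewrite /flat_weight (bigD1 L) //= -addnA; congr addn.
rewrite (bigID (fun f : {set E} => [disjoint f & L])) /= addnC; congr addn.
  transitivity (\sum_(p in L) \sum_(f in flats M | (f != L) && (p \in f))
      #|f|.-1)%N; last first.
    rewrite -sum_nat_const; apply: eq_bigr => p pL.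
    have := pencil_sum M p; rewrite (bigD1 L) ?LF ?pL //=.
    under eq_bigl => f do rewrite -andbA [_ && (f != L)]andbC.
    move=> pencil_p; apply: (@addnI #|L|.-1); rewrite pencil_p.
    have leLE : (#|L| <= #|E|)%N by exact: max_card.
    by lia.
  rewrite (exchange_big_dep (fun f => (f \in flats M) && (f != L))) /=;
    last by move=> p f _ /and3P[-> ->].
  rewrite [RHS](bigID (fun f : {set E} => [disjoint f & L])) /=.
  rewrite [X in (_ = X + _)%N]big1 ?add0n; last first.
    move=> f /andP[_ dfL]; apply: big1 => p /and4P[pL _ _ pf].
    by rewrite (disjointFr dfL pf) in pL.
  apply: eq_bigr => f /andP[/andP[fF fL]] /pred0Pn[p /= /andP[pf pL]].
  rewrite (bigD1 p) ?fF ?fL ?pL ?pf //= big1 ?addn0 //.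
  move=> q /andP[/andP[qL qf] qp]; case/negP: fL; apply/eqP.
  exact: (flat_uniq fF LF qp).
apply: eq_bigl => f; case fF: (f \in flats M) => //=.
case: (eqVneq f L) => //= ->; apply/esym/pred0Pn.
by have [x [y [xL _ _]]] := flat_two LF; exists x; rewrite /= xL.
Qed.

(** * The expected dimension *)

(** An edge amounts to an incident pair of a point and a flat. *)
Lemma card_edges_GammaM (E : finType) (M : matroid3 E) :
  (#|edges (@GammaM E M)| = \sum_(f in flats M) #|f|)%N.
Proof.
pose I := [set u : E * {f : {set E} | f \in flats M} | u.1 \in val u.2].
pose h (u : E * {f : {set E} | f \in flats M}) : {set vertexM M} :=
  [set inl u.1; inr u.2].
have -> : edges (@GammaM E M) = [set h u | u in I].
  apply/setP => A; rewrite inE; apply/idP/imsetP => [|[[e f]]].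
    case/existsP=> -[e|f] /existsP[[e'|f']] //= /andP[ef /eqP->].
      by exists (e, f'); rewrite // inE.
    by exists (e', f); rewrite ?inE //; apply: setUC.
  rewrite inE /= => ef ->.
  by apply/existsP; exists (inl e); apply/existsP; exists (inr f); rewrite /= ef /=.
rewrite card_in_imset; last first.
  move=> [e f] [e' f'] _ _ /setP eqh.
  have := eqh (inl e); have := eqh (inr f).
  rewrite !inE !eqxx /= ?orbT => /esym/eqP[->] /esym.
  by rewrite orbF => /eqP[->].
rewrite -sum1_card.
rewrite (eq_bigl (fun u : E * {f | f \in flats M} =>
    true && (u.1 \in val u.2)));
  last by move=> u; rewrite inE.
rewrite -(pair_big_dep xpredT (fun e (f : {f | f \in flats M}) => e \in val f)
    (fun _ _ => 1%N)) /=.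
rewrite (exchange_big_dep xpredT) //=.
rewrite (reindex_omap (val : {f | f \in flats M} -> _) insub) /=.
  apply: eq_big => [f|f _]; first by rewrite (valP f) valK eqxx.
  by rewrite sum1_card.
by move=> f fF; rewrite insubT.
Qed.

Lemma rho_GammaM (E : finType) (M : matroid3 E) :
  rho (genus (@GammaM E M)) 2 (degree (divM M))
    = 5 * #|E|%:Z - 8 - 2 * (flat_weight M)%:Z.
Proof.
have degE : degree (divM M) = #|E|%:Z.
  rewrite /degree big_sumType /= [X in _ + X]big1 => [|f _]; last by rewrite ffunE.
  under eq_bigr => e _ do rewrite ffunE.
  by rewrite addr0 sumr_const cardT enumT natz.
have cardV : #|vertexM M| = (#|E| + #|flats M|)%N.
  by rewrite card_sum card_sig.
have weightE : (\sum_(f in flats M) #|f| = flat_weight M + #|flats M|)%N.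
  rewrite /flat_weight -sum1_card -big_split /=; apply: eq_bigr => f fF.
  by have := flat_gt1 fF; lia.
rewrite /rho /genus degE card_edges_GammaM cardV weightE; lia.
Qed.

Lemma flat_weight_U3 (E : finType) (M : matroid3 E) :
  (forall f, f \in flats M -> #|f| <= 2)%N ->
  (2 * flat_weight M = #|E| * #|E|.-1)%N.
Proof.
move=> flat_le2; rewrite -(flat_pairs_sum M) big_distrr /=.
apply: eq_bigr => f fF; have := flat_gt1 fF; have := flat_le2 f fF; nia.
Qed.

(** The weight of L and of the flats meeting it gives the inequality
    2 k t + 6 <= 3 k + 5 t for k = #|L|, which bounds k and t when k > 2 and
    t > 1.  For k = 2 it holds for every t, but then the weight is the number of
    pairs of points, which is quadratic in t. *)
Lemma max_flat_cases (E : finType) (M : matroid3 E) (L : {set E}) (t : nat) :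
  L \in flats M -> (forall f, f \in flats M -> #|f| <= #|L|)%N ->
  #|E| = (#|L| + t)%N -> (2 * flat_weight M + 8 <= 5 * #|E|)%N ->
  [\/ t = 1%N, #|L| = 2%N /\ t = 2%N,
      (2 < #|L| < 5)%N /\ t = 2%N | #|L| = 3%N /\ t = 3%N].
Proof.
move=> LF maxL cardE lowW; have Lgt1 := flat_gt1 LF.
have t_gt0 : (0 < t)%N.
  have [x xL] := flat_missing LF; have := cardsC L.
  have : (0 < #|~: L|)%N by apply/card_gt0P; exists x; rewrite inE.
  lia.
have := flat_weight_split LF; rewrite cardE addKn => weightE.
have lowW' : (2 * #|L| * t + 6 <= 3 * #|L| + 5 * t)%N by lia.
case: (eqVneq t 1%N) => [->|t1]; first by constructor 1.
have t_gt1 : (1 < t)%N by lia.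
have L_lt5 : (#|L| < 5)%N by nia.
have [L2|L_gt2] : #|L| = 2%N \/ (2 < #|L|)%N by lia.
  constructor 2; split=> //.
  have := @flat_weight_U3 E M; rewrite cardE -L2 => /(_ maxL); nia.
have [L3|L4] : #|L| = 3%N \/ #|L| = 4%N by lia.
  have [->|->] : t = 2%N \/ t = 3%N by nia.
    by constructor 3; rewrite L3.
  by constructor 4.
by constructor 3; rewrite L4; nia.
Qed.

(** * Recognizing a matroid from a set of lines or from vectors *)

(** Each flat of M is spanned by two points, and a set of flats covering all
    pairs contains the flat through them; hence it contains every flat. *)
Lemma flats_iso_cover (E E' : finType) (M : matroid3 E) (F : {set {set E'}})
    (phi : E' -> E) :
  bijective phi -> (forall f, f \in F -> phi @: f \in flats M) ->
  (forall x y : E', x != y -> exists f, [/\ f \in F, x \in f & y \in f]) ->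
  flats_iso (flats M) F.
Proof.
move=> [theta phiK thetaK] imF coverF; exists theta; first by exists phi.
have imK (f : {set E'}) : theta @: (phi @: f) = f.
  by rewrite -imset_comp (eq_imset _ phiK) imset_id.
have imK' (f : {set E}) : phi @: (theta @: f) = f.
  by rewrite -imset_comp (eq_imset _ thetaK) imset_id.
apply/setP => A; apply/imsetP/idP => [[f fF ->]|AF]; last first.
  by exists (phi @: A); rewrite ?imF ?imK.
have [x [y [xf yf xy]]] := flat_two fF.
have [|h [hF xh yh]] := coverF (theta x) (theta y).
  by rewrite (can_eq thetaK).
suff -> : f = phi @: h by rewrite imK.
apply: (flat_uniq fF (imF h hF) xy) => //.
  by rewrite -[x]thetaK imset_f.
by rewrite -[y]thetaK imset_f.
Qed.

(** A linear form vanishing on the smaller family but not on the larger one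
    makes the inclusion of spans strict. *)
Lemma span_dim_cutoff (K : fieldType) (E : finType) (v : E -> 'rV[K]_3)
    (A B : {set E}) (c : 'rV[K]_3) (z : E) :
  A \subset B -> z \in B -> (forall e, e \in A -> v e *m c^T = 0) ->
  v z *m c^T != 0 -> (span_dim v A < span_dim v B)%N.
Proof.
move=> /subsetP sAB zB cA cz; apply: rank_ltmx; rewrite ltmxE.
apply/andP; split.
  apply/sumsmx_subP => e eA.
  by apply: (sumsmx_sup e) => //; apply: sAB.
apply: contra cz => sBA; apply/eqP/sub_kermxP.
have: (<<v z>> <= kermx c^T)%MS; last by rewrite genmxE.
have vzB : (<<v z>> <= \sum_(e in B) <<v e>>)%MS by apply: (sumsmx_sup z).
apply: (submx_trans vzB); apply: (submx_trans sBA); apply/sumsmx_subP => e eA.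
by rewrite genmxE; apply/sub_kermxP/cA.
Qed.

(** A rank 3 matroid is represented by vectors as soon as each of its flats is
    cut out by a plane: separating points by flats shows that the vectors are
    nonzero and pairwise non-proportional, so that flats span exactly a plane,
    and every set of vectors in a plane lies in a flat. *)
Lemma flats_iso_vec (K : fieldType) (E E' : finType) (M : matroid3 E)
    (v : E' -> 'rV[K]_3) (phi : E' -> E) :
  bijective phi ->
  (forall f, f \in flats M -> exists c : 'rV[K]_3,
     forall e, (v e *m c^T == 0) = (phi e \in f)) ->
  flats_iso (flats M) (vec_flats v).
Proof.
move=> [theta phiK thetaK] cutout; exists theta; first by exists phi.
pose plane (B : {set E'}) := (1 < #|B|)%N && (span_dim v B == 2%N).
have mem_im (f : {set E}) e : (e \in theta @: f) = (phi e \in f).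
  by rewrite -{1}[e]phiK mem_imset //; apply: can_inj thetaK.
have dim_pair x y : x != y -> (1 < span_dim v [set x; y])%N.
  rewrite -(can_eq phiK) => xy.
  have [f fF xf] := flat_avoid M (phi x).
  have [h [hF xh yh]] := flat_separate M xy.
  have [c cf] := cutout f fF; have [c' ch] := cutout h hF.
  apply: (@leq_ltn_trans (span_dim v [set x])).
    apply: (@leq_ltn_trans (span_dim v set0)) => //.
    apply: (@span_dim_cutoff _ _ _ _ _ c x); rewrite ?sub0set ?set11 //.
      by move=> e; rewrite inE.
    by rewrite cf.
  apply: (@span_dim_cutoff _ _ _ _ _ c' y); rewrite ?subsetUl ?set22 //.
    by move=> e /set1P->; apply/eqP; rewrite ch.
  by rewrite ch.
have plane_sub B : plane B -> exists2 f, f \in flats M & B \subset theta @: f.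
  case/andP=> /card_gt1P[x [y [xB yB xy]]] /eqP dimB.
  have phixy : phi x != phi y by rewrite (can_eq phiK).
  have [f [fF xf yf]] := flat_through M phixy.
  have [c cf] := cutout f fF; exists f => //; apply/subsetP => z zB.
  rewrite mem_im; apply: contraT => zf; have := dim_pair x y xy.
  rewrite ltnNge -ltnS -dimB (@span_dim_cutoff _ _ _ _ _ c z) //.
  - by apply/subsetP => e /set2P[]->.
  - by move=> e /set2P[]->; apply/eqP; rewrite cf.
  by rewrite cf.
have flat_plane (f : {set E}) : f \in flats M -> plane (theta @: f).
  move=> fF; have [x [y [xf yf xy]]] := flat_two fF.
  have sub : [set theta x; theta y] \subset theta @: f.
    by apply/subsetP => e /set2P[]->; rewrite imset_f.
  rewrite /plane card_imset; last exact: can_inj thetaK.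
  rewrite (flat_gt1 fF) /= eqn_leq; apply/andP; split.
    have [z zf] := flat_missing fF; have [c cf] := cutout f fF.
    rewrite -ltnS; apply: (@leq_trans (span_dim v setT)); last exact: rank_leq_col.
    apply: (@span_dim_cutoff _ _ _ _ _ c (theta z)); rewrite ?subsetT ?inE //.
      by move=> e; rewrite mem_im -cf => /eqP.
    by rewrite cf thetaK.
  have := dim_pair (theta x) (theta y); rewrite (can_eq thetaK) => /(_ xy).
  move/leq_trans; apply; apply: mxrankS; apply/sumsmx_subP => e eA.
  by apply: (sumsmx_sup e) => //; apply: (subsetP sub).
have im_sub (f f' : {set E}) : f \in flats M -> f' \in flats M ->
    theta @: f \subset theta @: f' -> f = f'.
  move=> fF f'F /subsetP sff'; apply: (flat_sub_eq fF f'F); apply/subsetP => e ef.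
  by have := sff' (theta e); rewrite !mem_im thetaK; apply.
apply/setP => A; rewrite inE; apply/imsetP/maxsetP => [[f fF ->]|[planeA maxA]].
  split=> [|B /plane_sub[f' f'F sBf'] sfB]; first exact: flat_plane.
  have ff' := im_sub f f' fF f'F (subset_trans sfB sBf').
  by apply/eqP; rewrite eqEsubset sfB ff' sBf'.
have [f fF sAf] := plane_sub A planeA; exists f => //.
by rewrite (maxA _ (flat_plane f fF) sAf).
Qed.

(** * One element extensions and the uniform matroid *)

(** The line through the extra point a and a point of L meets L only once, so it
    has no third point. *)
Lemma flats_iso_ext_U2 (E : finType) (M : matroid3 E) (L : {set E}) :
  L \in flats M -> #|E| = (#|L| + 1)%N -> is_ext_U2 M.
Proof.
move=> LF cardE; rewrite /is_ext_U2 cardE addn1 /=.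
have [a aL] := flat_missing LF.
have aL' x : x != a -> x \in L.
  move=> xa; apply: contraT => xL; have := cardsC L; rewrite cardE.
  have : (1 < #|~: L|)%N.
    by apply/card_gt1P; exists x, a; rewrite !inE.
  by lia.
pose phi o := if o is Some i then enum_val (i : 'I_#|L|) else a.
have phiL i : phi (Some i) \in L := enum_valP i.
have phi_inj : injective phi.
  move=> [i|] [j|] //=; first by move/enum_val_inj->.
    by move=> e; have := phiL i; rewrite /= e (negPf aL).
  by move=> e; have := phiL j; rewrite /= -e (negPf aL).
have phi_bij : bijective phi.
  by apply: inj_card_bij => //; rewrite card_option card_ord cardE addn1.
have imL : phi @: [set Some i | i : 'I_#|L|] = L.
  apply/eqP; rewrite eqEcard; apply/andP; split.
    by apply/subsetP => _ /imsetP[_ /imsetP[i _ ->] ->].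
  by rewrite !card_imset ?cardsT ?card_ord //; apply: Some_inj.
apply: (flats_iso_cover phi_bij) => [A|].
  case/setUP=> [/set1P->|/imsetP[i _ ->]]; first by rewrite imL.
  have ai : a != phi (Some i) by apply: contraNneq aL => ->.
  have [f [fF af jf]] := flat_through M ai.
  suff <- : f = phi @: [set None; Some i] by [].
  rewrite imsetU !imset_set1; apply/setP => x; rewrite in_set2.
  apply/idP/orP => [xf|[]/eqP-> //].
  case: (eqVneq x a) => [|xa]; [by left | right].
  apply: contraNT aL => xi.
  by rewrite -(flat_uniq fF LF xi xf jf (aL' x xa) (phiL i)).
have pair_ext i : [set None; Some i] \in ext_U2 #|L|.
  by apply/setUP; right; apply: imset_f.
move=> [i|] [j|] // ij.
- exists [set Some i | i : 'I_#|L|].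
  by rewrite setU11 !imset_f.
- by exists [set None; Some i]; rewrite set21 set22 pair_ext.
by exists [set None; Some j]; rewrite set21 set22 pair_ext.
Qed.

Lemma flats_iso_U3 (E : finType) (M : matroid3 E) (n : nat) :
  #|E| = n -> (forall f, f \in flats M -> #|f| <= 2)%N ->
  flats_iso (flats M) (U3 n).
Proof.
move=> cardE flat_le2; subst n.
apply: (flats_iso_cover (@enum_val_bij _)) => [f|x y xy].
  rewrite inE => /cards2P[x [y [xy ->]]].
  have xy' : enum_val x != enum_val y by rewrite (inj_eq enum_val_inj).
  have [f' [f'F xf' yf']] := flat_through M xy'.
  rewrite imsetU !imset_set1.
  suff -> : [set enum_val x; enum_val y] = f' by [].
  apply/eqP; rewrite eqEcard cards2 xy' flat_le2 // andbT.
  by apply/subsetP => e /set2P[]->.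
by exists [set x; y]; rewrite inE cards2 xy set21 set22.
Qed.

(** * Vectors in three-space *)

Lemma vec3_dot (K : fieldType) (a b c a' b' c' : K) :
  (vec3 a b c *m (vec3 a' b' c')^T == 0) = (a * a' + b * b' + c * c' == 0).
Proof.
have -> : vec3 a b c *m (vec3 a' b' c')^T = (a * a' + b * b' + c * c')%:M.
  apply/matrixP => i j; rewrite !ord1 !mxE !big_ord_recl big_ord0 !mxE /=.
  by rewrite addr0 addrA mulr1n.
apply/eqP/eqP => [/matrixP/(_ 0 0)|->]; first by rewrite !mxE mulr1n.
by apply/matrixP => i j; rewrite !mxE mul0rn.
Qed.

Lemma vec3_eq (K : fieldType) (a b c a' b' c' : K) :
  (vec3 a b c == vec3 a' b' c') = [&& a == a', b == b' & c == c'].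
Proof.
apply/eqP/and3P => [/rowP eqv|[/eqP-> /eqP-> /eqP->] //].
have := eqv (@Ordinal 3 0 isT); have := eqv (@Ordinal 3 1 isT).
by have := eqv (@Ordinal 3 2 isT); rewrite !mxE /= => -> -> ->.
Qed.

(** The flats other than L and L' join a point of L to a point of L'.  With the
    common point x at (0,0,1), the form (t,s,-1) vanishes at (1,0,r) only for
    r = t, at (0,1,r) only for r = s, and not at x. *)
Lemma flats_iso_two_lines (K : fieldType) (E E' : finType) (M : matroid3 E)
    (L L' : {set E}) (x : E) (phi : E' -> E) (v : E' -> 'rV[K]_3) :
  L \in flats M -> L' \in flats M -> x \in L -> x \in L' ->
  L :|: L' = setT -> bijective phi -> injective v ->
  (forall e, [\/ phi e = x /\ v e = vec3 0 0 1,
                 phi e \in L :\ x /\ exists t, v e = vec3 1 0 t |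
                 phi e \in L' :\ x /\ exists t, v e = vec3 0 1 t]) ->
  flats_iso (flats M) (vec_flats v).
Proof.
move=> LF L'F xL xL' LL' phi_bij v_inj coord.
have LneL' : L != L'.
  apply/eqP => eqLL'; have [y] := flat_missing LF.
  by rewrite -[L]setUid {2}eqLL' LL' inE.
have inLL' y : y \in L -> y \in L' -> y = x.
  move=> yL yL'; apply: contraNeq LneL' => yx.
  by rewrite (flat_uniq LF L'F yx).
have inL y : y \in L :\ x -> (y \in L) * (y \in L' = false).
  rewrite !inE => /andP[yx yL]; split=> //.
  by apply: contraNF yx => yL'; rewrite (inLL' y).
have inL' y : y \in L' :\ x -> (y \in L = false) * (y \in L').
  rewrite !inE => /andP[yx yL']; split=> //.
  by apply: contraNF yx => yL; rewrite (inLL' y).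
apply: (flats_iso_vec phi_bij) => f fF.
case: (eqVneq f L) => [->|fL].
  exists (vec3 0 1 0) => e.
  case: (coord e) => [[phie ->]|[/inL phie [t ->]]|[/inL' phie [t ->]]];
    by rewrite vec3_dot phie ?xL !(mulr0, mulr1, addr0, add0r) ?eqxx ?oner_eq0.
case: (eqVneq f L') => [->|fL'].
  exists (vec3 1 0 0) => e.
  case: (coord e) => [[phie ->]|[/inL phie [t ->]]|[/inL' phie [t ->]]];
    by rewrite vec3_dot phie ?xL' !(mulr0, mulr1, addr0, add0r) ?eqxx ?oner_eq0.
have meetL y z : y \in f -> z \in f -> y \in L -> z \in L -> y = z.
  move=> yf zf yL zL; apply: contraNeq fL => yz.
  by rewrite (flat_uniq fF LF yz).
have meetL' y z : y \in f -> z \in f -> y \in L' -> z \in L' -> y = z.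
  move=> yf zf yL zL; apply: contraNeq fL' => yz.
  by rewrite (flat_uniq fF L'F yz).
have covLL' y : (y \in L) || (y \in L') by rewrite -in_setU LL' inE.
have [y [z [yf zf yL zL']]] : exists y z,
    [/\ y \in f, z \in f, y \in L :\ x & z \in L' :\ x].
  have [y [z [yf zf yz]]] := flat_two fF.
  have off u w : u \in f -> w \in f -> u != w -> u \in L -> w \in L' ->
      (u \in L :\ x) /\ (w \in L' :\ x).
    move=> uf wf uw uL wL'; rewrite !inE uL wL' !andbT.
    split; apply: contra uw => /eqP eqx; apply/eqP.
      by apply: meetL' => //; rewrite eqx.
    by apply: meetL => //; rewrite eqx.
  have zy : z != y by rewrite eq_sym.
  case/orP: (covLL' y) => yL; case/orP: (covLL' z) => zL.
  - by rewrite (meetL y z) ?eqxx in yz.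
  - by exists y, z; case: (off y z).
  - by exists z, y; case: (off z y).
  - by rewrite (meetL' y z) ?eqxx in yz.
have [theta phiK thetaK] := phi_bij.
have xf : x \notin f.
  case/setD1P: yL => /eqP yx yL; apply/negP => xf; apply: yx; exact: meetL.
have [t vy] : exists t, v (theta y) = vec3 1 0 t.
  case: (coord (theta y)); rewrite thetaK => -[] //.
    by move=> yx; rewrite yx !inE eqxx in yL.
  by move/inL'; rewrite (inL y yL) => -[].
have [s vz] : exists s, v (theta z) = vec3 0 1 s.
  case: (coord (theta z)); rewrite thetaK => -[] //.
    by move=> zx; rewrite zx !inE eqxx in zL'.
  by move/inL; rewrite (inL' z zL') => -[].
exists (vec3 t s (-1)) => e.
case: (coord e) => [[phie ->]|[phie [r ve]]|[phie [r ve]]].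
- rewrite vec3_dot phie (negPf xf) !mul0r !add0r mul1r.
  by rewrite oppr_eq0 oner_eq0.
- rewrite ve vec3_dot mul1r mul0r addr0 mulrN1 subr_eq0.
  apply/eqP/idP => [tr|ef].
    suff -> : e = theta y by rewrite thetaK.
    by apply: v_inj; rewrite ve vy tr.
  have ey : e = theta y.
    by rewrite -(meetL (phi e) y) ?phiK ?(inL _ phie) ?(inL _ yL).
  by move: ve; rewrite ey vy => /eqP; rewrite vec3_eq => /and3P[_ _ /eqP].
- rewrite ve vec3_dot mul1r mul0r add0r mulrN1 subr_eq0.
  apply/eqP/idP => [tr|ef].
    suff -> : e = theta z by rewrite thetaK.
    by apply: v_inj; rewrite ve vz tr.
  have ez : e = theta z.
    by rewrite -(meetL' (phi e) z) ?phiK ?(inL' _ phie) ?(inL' _ zL').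
  by move: ve; rewrite ez vz => /eqP; rewrite vec3_eq => /and3P[_ _ /eqP].
Qed.

(** * The complete quadrilateral *)

(** M is the matroid of the six intersections of four lines: pt names a point by
    the two lines that pass through it. *)
Definition quadrilateral (E : finType) (M : matroid3 E) (pt : E -> pair4) :=
  [/\ bijective pt,
      forall i, [set e | i \in val (pt e)] \in flats M &
      forall f, f \in flats M -> (2 < #|f|)%N ->
        exists i, f = [set e | i \in val (pt e)]].

(** Four vectors in K^3 satisfy a relation sum a_i l_i = 0 whose coefficients are
    not all zero.  Evaluated at the point common to two of the lines it relates
    the other two coefficients, so no a_i vanishes.  A two-element flat consists
    of the points named by a set S of two indices and by its complement, and both
    are killed by the sum of a_i l_i over S, which by the relation is minus the
    sum over the complement.  At any other point exactly one of the two terms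
    survives. *)
Lemma flats_iso_quadrilateral (K : fieldType) (E E' : finType)
    (M : matroid3 E) (pt : E -> pair4) (psi : E' -> pair4)
    (l : 'I_4 -> 'rV[K]_3) (v : E' -> 'rV[K]_3) :
  quadrilateral M pt -> bijective psi ->
  (forall e i, (v e *m (l i)^T == 0) = (i \in val (psi e))) ->
  flats_iso (flats M) (vec_flats v).
Proof.
move=> [[tp ptK tpK] lineF line3] psi_bij inc.
have [ips psiK ipsK] := psi_bij.
pose phi e := tp (psi e).
have phi_bij : bijective phi.
  by apply: bij_comp => //; exists pt.
have ptphi e : pt (phi e) = psi e by rewrite /phi tpK.
have [a a0 rel] : exists2 a : 'rV[K]_4, a != 0 & \sum_i a 0 i *: l i = 0.
  pose A := \matrix_i l i.
  have : kermx A != 0.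
    rewrite -mxrank_eq0 mxrank_ker subn_eq0 -ltnNge.
    exact: leq_ltn_trans (rank_leq_col A) _.
  case/rowV0Pn=> a /sub_kermxP aA a0; exists a => //.
  by rewrite -[RHS]aA mulmx_sum_row; apply: eq_bigr => i _; rewrite rowK.
have rel_v e : \sum_i a 0 i *: (v e *m (l i)^T) = 0.
  transitivity (v e *m (\sum_i a 0 i *: l i)^T); last by rewrite rel trmx0 mulmx0.
  rewrite linear_sum mulmx_sumr; apply: eq_bigr => i _.
  by rewrite linearZ /= scalemxAr.
have a_neq0 i : a 0 i != 0.
  (* If a_i = 0, evaluate at the point on the two lines other than i and j. *)
  have [j aj] : exists j, a 0 j != 0 by apply/rV0Pn.
  apply: contraTneq aj => ai; apply/negPn.
  have [-> |ij] := eqVneq j i; first by rewrite ai.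
  have cardD : #|~: [set i; j]| == 2%N.
    have := cardsC [set i; j]; rewrite card_ord cards2 eq_sym ij => cardD.
    by apply/eqP; lia.
  pose e := ips (Sub (~: [set i; j]) cardD).
  have psie k : (k \in val (psi e)) = (k \notin [set i; j]).
    by rewrite ipsK SubK inE.
  have := rel_v e; rewrite (bigD1 j) //= big1 => [|k kj].
    rewrite addr0 => /eqP; rewrite scalemx_eq0 inc psie set22 /=.
    by rewrite orbF.
  have [->|ki] := eqVneq k i; first by rewrite ai scale0r.
  apply/eqP; rewrite scalemx_eq0 inc psie !inE negb_or ki kj.
  by rewrite orbT.
apply: (flats_iso_vec phi_bij) => f fF.
case: (boolP [exists i, f == [set e | i \in val (pt e)]]).
  by case/existsP=> i /eqP->; exists (l i) => e; rewrite inc inE ptphi.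
rewrite negb_exists => /forallP not_line.
have f2 : #|f| == 2%N.
  rewrite eqn_leq (flat_gt1 fF) andbT leqNgt; apply/negP => f3.
  by have [i fi] := line3 f fF f3; have := not_line i; rewrite {1}fi eqxx.
have /cards2P[u [w [uw fE]]] := f2.
have disj i : i \in val (pt u) -> i \notin val (pt w).
  move=> iu; apply: contra (not_line i) => iw; apply/eqP.
  by apply: (flat_uniq fF (lineF i) uw); rewrite ?fE ?set21 ?set22 ?inE.
have ptw : val (pt w) = ~: val (pt u).
  apply/eqP; rewrite eqEcard; apply/andP; split.
    by apply/subsetP => i iw; rewrite inE; apply: contraL iw; apply: disj.
  have := cardsC (val (pt u)); rewrite card_ord.
  by rewrite (eqP (valP (pt u))) (eqP (valP (pt w))) => cardD; lia.
pose S := val (pt u).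
exists (\sum_(i in S) a 0 i *: l i) => e.
have -> : v e *m (\sum_(i in S) a 0 i *: l i)^T
    = \sum_(i in S) a 0 i *: (v e *m (l i)^T).
  rewrite linear_sum mulmx_sumr; apply: eq_bigr => i _.
  by rewrite linearZ /= scalemxAr.
have term0 i : i \in val (psi e) -> a 0 i *: (v e *m (l i)^T) = 0.
  by rewrite -inc => /eqP->; rewrite scaler0.
have pt_inj : injective pt by apply: can_inj ptK.
have eq_pair (A B : pair4) : (A == B) = (val A == val B) by [].
rewrite fE !inE -!(inj_eq pt_inj) !eq_pair ptphi ptw -/S.
set T := val (psi e).
have cardT : #|T| = 2%N by apply/eqP: (valP (psi e)).
have cardS : #|S| = 2%N by apply/eqP: (valP (pt u)).
case: (eqVneq T S) => [TS|TS].
  by rewrite big1 ?eqxx // => i iS; apply: term0; rewrite -TS in iS.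
case: (eqVneq T (~: S)) => [TS'|TS'] /=.
  have := rel_v e; rewrite (bigID (mem S)) /= [X in _ + X]big1 ?addr0 => [->|i iS].
    exact: eqxx.
  by apply: term0; rewrite -/T TS' inE.
(* T is neither S nor its complement, so S and T share exactly one index. *)
have cardI : (#|S :&: T| + #|S :\: T| = 2)%N by rewrite cardsID.
have notD2 : #|S :\: T| != 2%N.
  apply: contra TS' => /eqP D2; rewrite eqEcard; apply/andP; split.
    have : S :&: T == set0 by rewrite -cards_eq0; lia.
    by rewrite setI_eq0 disjoint_sym disjoints_subset.
  by have := cardsC S; rewrite card_ord cardS cardT => cardD; lia.
have notD0 : #|S :\: T| != 0%N.
  apply: contra TS; rewrite cards_eq0 setD_eq0 => ST.
  by rewrite eq_sym eqEcard ST cardT cardS.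
have /cards1P[i Di] : #|S :\: T| == 1%N by lia.
have /setDP[iS iT] : i \in S :\: T by rewrite Di set11.
rewrite (bigD1 i) //= big1 ?addr0 => [|j /andP[jS ji]].
  by rewrite scalemx_eq0 (negPf (a_neq0 i)) inc -/T (negPf iT).
apply: term0; apply: contraNT ji => jT.
by rewrite -in_set1 -Di inE jT.
Qed.

Lemma card_pair4 : #|pair4| = 6%N.
Proof.
rewrite card_sig -[RHS]/('C(4, 2)) -[in RHS](card_ord 4) -card_draws.
by apply: eq_card => A; rewrite !inE.
Qed.

(** Flats have two or three points, so |f| (|f| - 1) is 2 (|f| - 1), plus 2 when
    |f| = 3; summing, 30 = 22 + 2 |T| for the set T of flats of size three.  The
    pencil of a point weighs five, hence contains at most two members of T; since
    the four members of T have twelve incidences with six points, it contains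
    exactly two. *)
Lemma quadrilateral_exists (E : finType) (M : matroid3 E) :
  #|E| = 6%N -> (forall f, f \in flats M -> #|f| <= 3)%N ->
  flat_weight M = 11%N -> exists pt, quadrilateral M pt.
Proof.
move=> cardE flat_le3 weightE.
pose T := [set f in flats M | #|f| == 3%N].
have memT f : (f \in T) = (f \in flats M) && (#|f| == 3%N) by rewrite inE.
have TF f : f \in T -> f \in flats M by rewrite memT => /andP[].
have T3 f : f \in T -> #|f| = 3%N by rewrite memT => /andP[_ /eqP].
clearbody T.
have cardT : #|T| = 4%N.
  have := flat_pairs_sum M; rewrite cardE.
  rewrite (eq_bigr (fun f : {set E} => 2 * #|f|.-1 + 2 * (#|f| == 3))%N); last first.
    move=> f fF; have := flat_gt1 fF; have := flat_le3 f fF.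
    by case: #|f| => [|[|[|[|?]]]].
  rewrite big_split /= -!big_distrr /= -/(flat_weight M) weightE.
  rewrite (_ : \sum_(f in flats M) (#|f| == 3) = #|T|)%N.
    move=> pairsE; apply/eqP.
    by rewrite -(eqn_pmul2l (isT : 0 < 2)%N) -(eqn_add2l (2 * 11)) pairsE.
  rewrite -sum1_card big_mkcond [RHS]big_mkcond; apply: eq_bigr => f _.
  by rewrite memT; case: (f \in flats M); case: (#|f| == 3).
pose deg e := #|[set f in T | e \in f]|.
have deg_le2 e : (deg e <= 2)%N.
  have := pencil_sum M e; rewrite cardE (bigID (mem T)) /=.
  rewrite (eq_bigl (mem [set f in T | e \in f])); last first.
    move=> f /=; rewrite !inE memT; case fF: (f \in flats M) => //=.
    by rewrite andbC.
  rewrite (eq_bigr (fun=> 2%N)); last by move=> f; rewrite /= in_set => /andP[/T3-> _].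
  by rewrite sum_nat_const -/(deg e); lia.
have deg_sum : (\sum_e deg e = 12)%N.
  transitivity (\sum_e \sum_(f in T | e \in f) 1)%N.
    by apply: eq_bigr => e _; rewrite /deg -sum1_card; apply: eq_bigl => f; rewrite !inE.
  rewrite (exchange_big_dep (mem T)) /=; last by move=> e f _ /andP[].
  rewrite (eq_bigr (fun=> 3%N)) => [|f fT]; first by rewrite sum_nat_const cardT.
  by rewrite -(T3 f fT) -sum1_card; apply: eq_bigl => e; rewrite fT.
have deg2 e : deg e = 2%N.
  have : (\sum_e (2 - deg e) = 0)%N.
    have : (\sum_e ((2 - deg e) + deg e) = 12)%N.
      rewrite (eq_bigr (fun=> 2%N)) => [|i _]; last by rewrite subnK.
      by rewrite sum_nat_const [X in (X * _)%N]cardE.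
    by rewrite big_split /= deg_sum; lia.
  move/eqP; rewrite sum_nat_eq0 => /forallP/(_ e) /= /eqP.
  by have := deg_le2 e; lia.
pose line (i : 'I_4) := enum_val (cast_ord (esym cardT) i).
have lineT i : line i \in T by apply: enum_valP.
have line_inj : injective line.
  by move=> i j /enum_val_inj/cast_ord_inj.
have line_onto f : f \in T -> exists i, f = line i.
  move=> fT; exists (cast_ord cardT (enum_rank_in fT f)).
  by rewrite /line cast_ordK enum_rankK_in.
pose S e := [set i | e \in line i].
have cardS e : #|S e| == 2%N.
  apply/eqP; rewrite -[RHS](deg2 e) -(card_imset (mem (S e)) line_inj).
  apply: eq_card => f.
  apply/imsetP/idP => [[i]|]; first by rewrite !inE => ei ->; rewrite lineT.
  by rewrite !inE => /andP[/line_onto[i ->] ei]; exists i; rewrite // !inE.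
pose pt e : pair4 := Sub (S e) (cardS e).
have lineE i : [set e | i \in val (pt e)] = line i.
  by apply/setP => e; rewrite !inE.
exists pt; split=> [|i|f fF f3]; last first.
- have [i fi] : exists i, f = line i.
    by apply: line_onto; rewrite memT fF eqn_leq flat_le3.
  by exists i; rewrite lineE.
- by rewrite lineE; apply/TF/lineT.
apply: inj_card_bij; last by rewrite card_pair4 cardE.
move=> e e' /(congr1 val) /= eqS; apply/eqP; apply: contraT => ee'.
have /cards2P[i [j [ij Se]]] := cardS e.
have [ei ej] : e \in line i /\ e \in line j.
  by have : i \in S e /\ j \in S e; [rewrite Se set21 set22 | rewrite !inE].
have [ei' ej'] : e' \in line i /\ e' \in line j.
  by have : i \in S e' /\ j \in S e'; [rewrite -eqS Se set21 set22 | rewrite !inE].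
case/negP: ij; apply/eqP/line_inj.
exact: (flat_uniq (TF _ (lineT i)) (TF _ (lineT j)) ee').
Qed.

(** * The representing vectors *)

(** By cardinality, listing all points in n entries leaves no room for
    repetitions. *)
Lemma tnth_bijective (E : finType) (n : nat) (t : n.-tuple E) :
  #|E| = n -> (forall e, e \in t) -> bijective (tnth t).
Proof.
move=> cardE cover; apply: inj_card_bij; last by rewrite cardE card_ord.
apply/tuple_uniqP; apply: (leq_size_uniq (enum_uniq E)) => [e _|].
  exact: cover.
by rewrite size_tuple -cardE -cardT.
Qed.

Lemma is_five_vecs_two_lines (E : finType) (M : matroid3 E) (L L' : {set E})
    (x : E) :
  L \in flats M -> L' \in flats M -> x \in L -> x \in L' ->
  L :|: L' = setT -> #|E| = 5%N -> #|L :\ x| = 2%N -> #|L' :\ x| = 2%N ->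
  is_five_vecs M.
Proof.
move=> LF L'F xL xL' cover cardE /eqP/cards2P[y [z [_ LE]]].
move=> /eqP/cards2P[a [b [_ L'E]]] K.
have all_pts e : e \in [tuple y; z; x; a; b].
  have : e \in L :|: L' by rewrite cover inE.
  rewrite -(setD1K xL) -(setD1K xL') LE L'E !inE.
  by do ![case: (_ == _) => //].
apply: (flats_iso_two_lines LF L'F xL xL' cover (tnth_bijective cardE all_pts)).
  apply/tuple_uniqP.
  by rewrite /= !inE !vec3_eq !eqxx !(eq_sym 0 1) !oner_eq0 /=.
rewrite LE L'E; case=> -[|[|[|[|[|//]]]]] lt5; rewrite !(tnth_nth x) /= ?(tnth_nth 0) /=.
- by constructor 2; split; [rewrite set21 | exists 0].
- by constructor 2; split; [rewrite set22 | exists 1].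
- by constructor 1.
- by constructor 3; split; [rewrite set21 | exists 1].
- by constructor 3; split; [rewrite set22 | exists 0].
Qed.

Lemma is_six_vecs_two_lines (E : finType) (M : matroid3 E) (L L' : {set E})
    (x : E) :
  L \in flats M -> L' \in flats M -> x \in L -> x \in L' ->
  L :|: L' = setT -> #|E| = 6%N -> #|L :\ x| = 3%N -> #|L' :\ x| = 2%N ->
  is_six_vecs M.
Proof.
move=> LF L'F xL xL' cover cardE L3.
have [w wL] : exists w, w \in L :\ x by apply/card_gt0P; rewrite L3.
have /eqP/cards2P[y [z [_ LE]]] : #|L :\ x :\ w| = 2%N.
  by have := cardsD1 w (L :\ x); rewrite wL L3 => -[].
move=> /eqP/cards2P[a [b [_ L'E]]] K lambda lambda0 lambda1.
have all_pts e : e \in [tuple y; z; x; a; b; w].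
  have : e \in L :|: L' by rewrite cover inE.
  rewrite -(setD1K xL) -(setD1K xL') -(setD1K wL) LE L'E !inE.
  by do ![case: (_ == _) => //].
apply: (flats_iso_two_lines LF L'F xL xL' cover (tnth_bijective cardE all_pts)).
  apply/tuple_uniqP; rewrite /= !inE !vec3_eq !eqxx !(eq_sym 0 1) !oner_eq0.
  by rewrite !(eq_sym _ lambda) (negPf lambda0) (negPf lambda1).
rewrite -(setD1K wL) LE L'E.
case=> -[|[|[|[|[|[|//]]]]]] lt6; rewrite !(tnth_nth x) /= ?(tnth_nth 0) /=.
- by constructor 2; split; [rewrite !inE eqxx orbT | exists 0].
- by constructor 2; split; [rewrite !inE eqxx !orbT | exists 1].
- by constructor 1.
- by constructor 3; split; [rewrite set21 | exists 1].
- by constructor 3; split; [rewrite set22 | exists 0].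
- by constructor 2; split; [rewrite setU11 | exists lambda].
Qed.

(** Three generic lines span the dual space, so no nonzero vector lies on all of
    them. *)
Lemma intersection_points_inc (K : fieldType) (l : 'I_4 -> 'rV[K]_3)
    (p : pair4 -> 'rV[K]_3) (A : pair4) (i : 'I_4) :
  generic_lines l -> intersection_points l p ->
  (p A *m (l i)^T == 0) = (i \in val A).
Proof.
move=> gen inter; have [pA0 pA] := inter A.
apply/eqP/idP => [pi|]; last exact: pA.
apply: contraNT pA0 => iA.
have cardB : #|i |: val A| = 3%N by rewrite cardsU1 iA (eqP (valP A)).
have full : row_full (\sum_(e in i |: val A) <<l e>>)%MS.
  by apply/eqP; exact: gen.
have sub : (\sum_(e in i |: val A) <<l e>> <= kermx (p A)^T)%MS.
  apply/sumsmx_subP => j jB; rewrite genmxE; apply/sub_kermxP.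
  apply: trmx_inj; rewrite trmx_mul trmxK trmx0.
  by case/setU1P: jB => [->|/pA].
have /sub_kermxP := submx_trans (submx_full 1%:M full) sub.
by rewrite mul1mx => /(congr1 trmx); rewrite trmxK trmx0 => ->.
Qed.

Lemma is_four_lines_quadrilateral (E : finType) (M : matroid3 E)
    (pt : E -> pair4) : quadrilateral M pt -> is_four_lines M.
Proof.
move=> quad; split=> [K l p gen inter|K].
  apply: (flats_iso_quadrilateral (psi := id) (l := l) quad); first by exists id.
  by move=> A i; exact: (intersection_points_inc _ _ gen inter).
(* The lines y = 0, x = 0, y = z and x = z carry three of the six vectors each;
   row k of the table below lists which lines contain the k-th vector. *)
pose l : 'I_4 -> 'rV[K]_3 :=
  tnth [tuple vec3 0 1 0; vec3 1 0 0; vec3 0 1 (-1); vec3 1 0 (-1)].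
pose inc (k : 'I_6) (i : 'I_4) : bool :=
  nth false (nth [::] [:: [:: true; false; true; false];
                          [:: true; false; false; true];
                          [:: true; true; false; false];
                          [:: false; true; true; false];
                          [:: false; true; false; true];
                          [:: false; false; true; true]] k) i.
have card_inc k : #|[set i | inc k i]| == 2%N.
  rewrite -sum1_card big_mkcond !big_ord_recl big_ord0 !inE.
  by case: k => -[|[|[|[|[|[|//]]]]]].
pose psi k : pair4 := Sub [set i | inc k i] (card_inc k).
apply: (flats_iso_quadrilateral (psi := psi) (l := l) quad) => [|k i].
  apply: inj_card_bij; last by rewrite card_pair4 card_ord.
  move=> k k' /(congr1 val)/setP eq_inc.
  have {}eq_inc i : inc k i = inc k' i by have := eq_inc i; rewrite !inE.
  apply/val_inj; move: (eq_inc (@Ordinal 4 0 isT)) (eq_inc (@Ordinal 4 1 isT)).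
  move: (eq_inc (@Ordinal 4 2 isT)).
  case: k {eq_inc} => -[|[|[|[|[|[|//]]]]]] ?;
    by case: k' => -[|[|[|[|[|[|//]]]]]] ?.
rewrite inE /l !(tnth_nth 0).
case: k => -[|[|[|[|[|[|//]]]]]] ?; case: i => -[|[|[|[|//]]]] ?;
  rewrite /= vec3_dot;
  by rewrite !(mulr0, mul0r, mulr1, mul1r, addr0, add0r, subrr, oppr_eq0, oner_eq0, eqxx).
Qed.

(** * The classification *)

Theorem theorem4p1 (E : finType) (M : matroid3 E) (n : nat) (g d : int)
    (hn : #|E| = n) (hg : g = genus (@GammaM E M)) (hd : d = degree (divM M))
    (hrho : 0 <= rho g 2 d) :
  (is_ext_U2 M /\ rho g 2 d = n%:Z - 2) \/
  (is_U34 M /\ rho g 2 d = 0) \/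
  (is_five_vecs M /\ rho g 2 d = 1) \/
  (is_six_vecs M /\ rho g 2 d = 0) \/
  (is_four_lines M /\ rho g 2 d = 0).
Proof.
have rhoE := rho_GammaM M; rewrite -hg -hd hn in rhoE.
have [L0 L0F] : exists L0, L0 \in flats M.
  by apply/card_gt0P; apply: ltnW; apply: flats_gt1.
case: (arg_maxnP (fun f : {set E} => #|f|) L0F) => L LF maxL {L0 L0F}.
have {}maxL f : f \in flats M -> (#|f| <= #|L|)%N by exact: maxL.
have cardE : #|E| = (#|L| + #|~: L|)%N by rewrite cardsC.
have lowW : (2 * flat_weight M + 8 <= 5 * #|E|)%N by rewrite hn; lia.
have Lgt1 := flat_gt1 LF.
have weightE := flat_weight_split LF; rewrite cardE addKn in weightE.
rewrite rhoE.
case: (max_flat_cases LF maxL cardE lowW) => [t1|[L2 t2]|[L34 t2]|[L3 t3]].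
- left; split.
    by apply: (flats_iso_ext_U2 LF); rewrite cardE t1.
  rewrite big1 in weightE; first by lia.
  move=> f /andP[fF]; rewrite disjoints_subset => /subset_leq_card.
  rewrite t1; lia.
- right; left; have cardE4 : #|E| = 4%N by rewrite cardE L2 t2.
  rewrite L2 in maxL; split; first exact: flats_iso_U3.
  by have := flat_weight_U3 maxL; rewrite cardE4; lia.
- right; right.
  (* L and the flats meeting it already have the largest weight allowed by rho. *)
  have no_disj : (\sum_(f in flats M | [disjoint f & L]) #|f|.-1 = 0)%N by nia.
  have /eqP/cards2P[a [b [ab LC]]] := t2.
  have [L' [L'F aL' bL']] := flat_through M ab.
  have [x xL' xL] : exists2 x, x \in L' & x \in L.
    case: (boolP [disjoint L' & L]) => [dis|/pred0Pn[x /andP[]]]; last by exists x.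
    move/eqP: no_disj; rewrite sum_nat_eq0 => /forallP/(_ L').
    by rewrite L'F dis; have := flat_gt1 L'F; lia.
  have cover : L :|: L' = setT.
    apply/setP => y; rewrite !inE; case: (boolP (y \in L)) => //= yL.
    have : y \in ~: L by rewrite inE.
    by rewrite LC => /set2P[]->.
  have L'E : L' :\ x = ~: L.
    apply/setP => y; rewrite !inE; case: (boolP (y \in L)) => [yL|yL] /=.
      apply/negP => /andP[yx yL'].
      have : a \notin L by rewrite -in_setC LC set21.
      by rewrite (flat_uniq LF L'F yx) ?aL'.
    have : y \in L :|: L' by rewrite cover inE.
    rewrite inE (negPf yL) /= => ->; rewrite andbT.
    by apply: contraNneq yL => ->.
  have L'2 : #|L' :\ x| = 2%N by rewrite L'E.
  have := cardsD1 x L; rewrite xL add1n => Lx.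
  have [L3|L4] : #|L| = 3%N \/ #|L| = 4%N by lia.
    left; split; last by lia.
    apply: (is_five_vecs_two_lines LF L'F xL xL' cover _ _ L'2); first by lia.
    by lia.
  right; left; split; last by lia.
  apply: (is_six_vecs_two_lines LF L'F xL xL' cover _ _ L'2); first by lia.
  by lia.
- do 4!right; split; last by lia.
  have [|||pt] := @quadrilateral_exists E M; last exact: is_four_lines_quadrilateral.
  + by rewrite cardE L3 t3.
  + by move=> f fF; rewrite -L3 maxL.
  by lia.
Qed.
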